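(* Let $V$ be a countably infinite dimensional vector space over a finite field $\mathbb{F}_q$ and let $H\leq\mathrm{GL}(V)$ be a highly linearly transitive group. Then exactly one of the following holds: (i) $H\cap\mathrm{GL}_{\rm fin}(V)$ is a highly linearly transitive, locally finite, normal subgroup of $H$; (ii) $H$ has no mixed identities.
   Context: Linear maps act on vectors from the right; $v.g$ is the image of $v\in V$ under $g$. A group $H\leq\mathrm{GL}(V)$ is linearly $k$-transitive if for all $k$-element sets of linearly independent vectors $\{u_1,\ldots,u_k\}$ and $\{w_1,\ldots,w_k\}$ of $V$ there is $h\in H$ with $u_i.h=w_i$ for all $i\in\{1,\dots,k\}$. It is highly linearly transitive if it is linearly $k$-transitive for every $k\ge1$. For $g\in\mathrm{GL}(V)$ put $|g|=\min_{\lambda\in\mathbb{F}_q^\times}\mathrm{rk}(g-\lambda 1_V)\in\mathbb{N}\cup\{\infty\}$, and $\mathrm{GL}_{\rm fin}(V)=\{g\in\mathrm{GL}(V):|g|<\infty\}$, a normal subgroup of $\mathrm{GL}(V)$. A group is locally finite if all its finitely generated subgroups are finite. Mixed identities. $\mathbf{F}_r=\langle x_1,\ldots,x_r\rangle$ is the free group of rank $r$. For $w\in H\ast\mathbf{F}_r$, $w(h_1,\dots,h_r)$ is the image of $w$ under the homomorphism $H\ast\mathbf{F}_r\to H$ that is the identity on $H$ and maps $x_i\mapsto h_i$. Write $w=c_0x_{\iota(1)}^{\varepsilon(1)}c_1\cdots c_{l-1}x_{\iota(l)}^{\varepsilon(l)}c_l$ with $c_j\in H$, $\iota(j)\in\{1,\dots,r\}$,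 $\varepsilon(j)\in\{\pm1\}$. This expression is reduced if, for every $j\in\{1,\dots,l-1\}$: when $\iota(j)=\iota(j+1)$ and $\varepsilon(j)=-\varepsilon(j+1)$, the constant $c_j$ does not lie in the centre of $H$; and otherwise $c_j$ is not a non-trivial element of the centre of $H$. A mixed identity for $H$ is a word $w\in H\ast\mathbf{F}_r$ (for some $r\geq1$) which is given by a reduced expression of length $l\geq1$ and satisfies $w(h_1,\dots,h_r)=1$ for all $h_1,\dots,h_r\in H$. *)

(* Defs.v *)
From HB Require Import structures.
From mathcomp Require Import all_boot all_order all_algebra.
From mathcomp Require Import boolp classical_sets cardinality.

Set Implicit Arguments.
Unset Strict Implicit.
Unset Printing Implicit Defensive.

Import GRing.Theory.

Local Open Scope ring_scope.

Section LinearAlgebra.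
Variables (F : fieldType) (V : lmodType F).

Definition lin_comb n (b : 'I_n -> V) (a : 'I_n -> F) : V :=
  \sum_(i < n) a i *: b i.

Definition lin_indep n (b : 'I_n -> V) : Prop :=
  forall a : 'I_n -> F, lin_comb b a = 0 -> forall i, a i = 0.

Definition basis_of n (U : set V) (b : 'I_n -> V) : Prop :=
  lin_indep b /\ U = range (lin_comb b).

Definition countably_infinite_dim : Prop :=
  exists e : nat -> V,
    (forall n, lin_indep (fun i : 'I_n => e i)) /\
    (forall v, exists n (a : 'I_n -> F), v = lin_comb (fun i : 'I_n => e i) a).

End LinearAlgebra.

(* [enat] is N U {oo}, with [None] standing for oo. *)
Definition enat : Type := option nat.

Definition emin (m n : enat) : enat :=
  match m, n with
  | Some i, Some j => Some (minn i j)
  | None, _ => n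
  | _, None => m
  end.

Lemma eminA : associative emin.
Proof. by case=> [i|] [j|] [k|] //=; rewrite minnA. Qed.
Lemma eminC : commutative emin.
Proof. by case=> [i|] [j|] //=; rewrite minnC. Qed.
Lemma emin0 : left_id None emin.
Proof. by []. Qed.
HB.instance Definition _ :=
  Monoid.isComLaw.Build enat None emin eminA eminC emin0.

Definition dimension (F : fieldType) (V : lmodType F) (U : set V) : enat :=
  if pselect (exists n (b : 'I_n -> V), basis_of U b) is left ex
  then Some (projT1 (cid ex)) else None.

Definition rk (F : fieldType) (V : lmodType F) (f : V -> V) : enat :=
  dimension (range f).

Section GeneralLinearGroup.
Variables (F : fieldType) (V : lmodType F).

Record GL : Type := MkGL {
  GL_fun :> V -> V;
  GL_linear : linear GL_fun;
  GL_bij : bijective GL_fun }.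

HB.instance Definition _ (g : GL) :=
  GRing.isLinear.Build F V V *:%R (GL_fun g) (GL_linear g).

HB.instance Definition _ := gen_eqMixin GL.
HB.instance Definition _ := gen_choiceMixin GL.

Lemma GLP (g h : GL) : g =1 h -> g = h.
Proof.
case: g h => [g gl gb] [h hl hb] /= /funext e; subst h.
by congr MkGL; exact: Prop_irrelevance.
Qed.

Fact GL1_linear : linear (@id V). Proof. by []. Qed.

Fact GL1_bij : bijective (@id V). Proof. by exists id. Qed.

Definition GL1 : GL := MkGL GL1_linear GL1_bij.

Fact GLM_linear (g h : GL) : linear (h \o g).
Proof. by move=> a u v /=; rewrite !linearP. Qed.

(* Maps act on the right: [v.(g * h) = (v.g).h], where [v.g] is [g v]. *)
Definition GLM (g h : GL) : GL :=
  MkGL (GLM_linear g h) (bij_comp (GL_bij h) (GL_bij g)).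

Fact GLV_exists (g : GL) : exists h : V -> V, cancel g h /\ cancel h g.
Proof. by case: (GL_bij g) => h gK hK; exists h. Qed.

Definition GLV_fun (g : GL) : V -> V := projT1 (cid (GLV_exists g)).

Lemma GLV_funK (g : GL) : cancel g (GLV_fun g).
Proof. by rewrite /GLV_fun; case: cid => h []. Qed.

Lemma GL_funVK (g : GL) : cancel (GLV_fun g) g.
Proof. by rewrite /GLV_fun; case: cid => h []. Qed.

Fact GLV_linear (g : GL) : linear (GLV_fun g).
Proof. exact: can2_linear (@GLV_funK g) (@GL_funVK g). Qed.

Definition GLV (g : GL) : GL :=
  MkGL (GLV_linear g) (Bijective (@GL_funVK g) (@GLV_funK g)).

Fact GL_mulA : associative GLM. Proof. by move=> f g h; exact: GLP. Qed.
Fact GL_mul1g : left_id GL1 GLM. Proof. by move=> g; exact: GLP. Qed.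
Fact GL_mulg1 : right_id GL1 GLM. Proof. by move=> g; exact: GLP. Qed.
Fact GL_mulVg : left_inverse GL1 GLV GLM.
Proof. by move=> g; apply: GLP => v; exact: GL_funVK. Qed.
Fact GL_mulgV : right_inverse GL1 GLV GLM.
Proof. by move=> g; apply: GLP => v; exact: GLV_funK. Qed.
HB.instance Definition _ :=
  isGroup.Build GL GL_mulA GL_mul1g GL_mulg1 GL_mulVg GL_mulgV.

Definition linearly_transitive (k : nat) (K : {pred GL}) : Prop :=
  forall u w : 'I_k -> V, lin_indep u -> lin_indep w ->
    exists2 h : GL, h \in K & forall i, h (u i) = w i.

Definition highly_linearly_transitive (K : {pred GL}) : Prop :=
  forall k : nat, (1 <= k)%N -> linearly_transitive k K.

End GeneralLinearGroup.

Section FinitaryMaps.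
Variables (F : finFieldType) (V : lmodType F).

Definition GLnorm (g : GL V) : enat :=
  \big[emin/None]_(l : F | l != 0) rk (fun v : V => g v - l *: v).

Definition GLfin : {pred GL V} := [pred g | GLnorm g != None :> option nat].

End FinitaryMaps.

Arguments GLfin {F} V.

Local Close Scope ring_scope.
Local Open Scope group_scope.

(* Subsets are boolean predicates, which is no restriction: [asbool] turns any
   [P : G -> Prop] into one. Accordingly [groupClosed G] is the type of all
   subgroups of G. *)
Section AbstractGroups.
Variable G : groupType.

Definition generated (s : seq G) : set G :=
  [set g | forall L : {pred G}, group_closed L -> {subset s <= L} -> g \in L].

Definition locally_finite (K : {pred G}) : Prop :=
  forall s : seq G, {subset s <= K} -> finite_set (generated s).

Definition normal_subgroup (K H : {pred G}) : Prop :=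
  [/\ group_closed K, {subset K <= H} & {in K & H, forall g h, g ^ h \in K}].

Definition center : {pred G} := [pred z | `[< forall x : G, commute z x >]].

End AbstractGroups.

Arguments center G : clear implicits.

Section SubgroupAsGroup.
Variables (G : groupType) (H : groupClosed G).

Definition subgroup : Type := {x : G | x \in H}.

HB.instance Definition _ := SubChoice.on subgroup.

Fact subgroup_closed : group_closed (fun x => x \in H).
Proof. by split=> [|x y xH yH]; [exact: gpred1 | exact: gpredF]. Qed.
HB.instance Definition _ :=
  SubChoice_isSubGroup.Build G (fun x => x \in H) subgroup subgroup_closed.

End SubgroupAsGroup.

(* The free product A * F_r, presented by the letters [inl a] for a in A and
   [inr (i, true)], [inr (i, false)] for x_i, x_i^-1, modulo the relations of A
   and the free cancellations. *)
Section FreeProduct.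
Variables (A : groupType) (r : nat).

Definition letter : Type := (A + 'I_r * bool)%type.
HB.instance Definition _ := Choice.on letter.

Inductive fp_eq : seq letter -> seq letter -> Prop :=
  | fp_refl s : fp_eq s s
  | fp_sym s t : fp_eq s t -> fp_eq t s
  | fp_trans t s u : fp_eq s t -> fp_eq t u -> fp_eq s u
  | fp_cat s s' t t' : fp_eq s s' -> fp_eq t t' -> fp_eq (s ++ t) (s' ++ t')
  | fp_const1 : fp_eq [:: inl 1] [::]
  | fp_constM a b : fp_eq [:: inl a; inl b] [:: inl (a * b)]
  | fp_cancel i e : fp_eq [:: inr (i, e); inr (i, ~~ e)] [::].

Definition fp_eqb : rel (seq letter) := fun s t => `[< fp_eq s t >].

Fact fp_eqb_refl : reflexive fp_eqb.
Proof. by move=> s; apply/asboolP; exact: fp_refl. Qed.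
Fact fp_eqb_sym : symmetric fp_eqb.
Proof. by move=> s t; apply/asboolP/asboolP; exact: fp_sym. Qed.
Fact fp_eqb_trans : transitive fp_eqb.
Proof.
by move=> t s u /asboolP st /asboolP tu; apply/asboolP; exact: fp_trans tu.
Qed.
Canonical fp_equiv := EquivRel fp_eqb fp_eqb_refl fp_eqb_sym fp_eqb_trans.

Definition freeprod : Type := {eq_quot fp_equiv}%qT.
HB.instance Definition _ := Choice.on freeprod.

Definition fp_class (s : seq letter) : freeprod := (\pi_{eq_quot fp_equiv} s)%qT.
Definition fp_repr (w : freeprod) : seq letter := repr w.

Lemma fp_reprK : cancel fp_repr fp_class.
Proof. by move=> w; exact: reprK. Qed.

Lemma fp_classP s t : fp_class s = fp_class t <-> fp_eq s t.
Proof.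
by split=> [/eqmodP/asboolP|st] //; apply/eqmodP/asboolP.
Qed.

Lemma fp_classK s : fp_eq (fp_repr (fp_class s)) s.
Proof. by apply/fp_classP; rewrite fp_reprK. Qed.

Definition letter_inv (x : letter) : letter :=
  match x with
  | inl a => inl a^-1
  | inr (i, e) => inr (i, ~~ e)
  end.

Definition fp_one : freeprod := fp_class [::].
Definition fp_mul (v w : freeprod) := fp_class (fp_repr v ++ fp_repr w).
Definition fp_inv (w : freeprod) := fp_class (rev (map letter_inv (fp_repr w))).

Lemma fp_mulE s t : fp_mul (fp_class s) (fp_class t) = fp_class (s ++ t).
Proof. by apply/fp_classP; apply: fp_cat; exact: fp_classK. Qed.

Lemma letter_invK : involutive letter_inv.
Proof. by case=> [a|[i e]] /=; rewrite ?invgK ?negbK. Qed.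

Lemma letter_mulV x : fp_eq [:: x; letter_inv x] [::].
Proof.
case: x => [a|[i e]] /=; last exact: fp_cancel.
by apply: fp_trans (fp_constM _ _) _; rewrite mulgV; exact: fp_const1.
Qed.

Lemma fp_word_mulV s : fp_eq (s ++ rev (map letter_inv s)) [::].
Proof.
elim: s => [|x s IHs]; first exact: fp_refl.
rewrite map_cons rev_cons -cats1 -cat1s -catA (catA s).
apply: fp_trans (letter_mulV x); apply: fp_cat (fp_refl _) _.
exact: (fp_cat IHs (fp_refl [:: letter_inv x])).
Qed.

Lemma fp_word_mulg s : fp_eq (rev (map letter_inv s) ++ s) [::].
Proof.
have := fp_word_mulV (rev (map letter_inv s)).
by rewrite map_rev revK (mapK letter_invK).
Qed.

Fact fp_mulA : associative fp_mul.
Proof.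
move=> u v w; rewrite -[u]fp_reprK -[v]fp_reprK -[w]fp_reprK.
by rewrite !fp_mulE catA.
Qed.
Fact fp_mul1g : left_id fp_one fp_mul.
Proof. by move=> w; rewrite -[w]fp_reprK fp_mulE. Qed.
Fact fp_mulg1 : right_id fp_one fp_mul.
Proof. by move=> w; rewrite -[w]fp_reprK fp_mulE cats0. Qed.
Fact fp_mulVg : left_inverse fp_one fp_inv fp_mul.
Proof.
move=> w; rewrite -[X in fp_mul _ X]fp_reprK fp_mulE.
by apply/fp_classP; exact: fp_word_mulg.
Qed.
Fact fp_mulgV : right_inverse fp_one fp_inv fp_mul.
Proof.
move=> w; rewrite -[X in fp_mul X _]fp_reprK fp_mulE.
by apply/fp_classP; exact: fp_word_mulV.
Qed.
HB.instance Definition _ :=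
  isGroup.Build freeprod fp_mulA fp_mul1g fp_mulg1 fp_mulVg fp_mulgV.

Definition fp_const (a : A) : freeprod := fp_class [:: inl a].
Definition fp_var (i : 'I_r) : freeprod := fp_class [:: inr (i, true)].

Lemma fp_constE : monoid.monoid_morphism fp_const.
Proof.
split; first by apply/fp_classP; exact: fp_const1.
by move=> a b; symmetry; rewrite [LHS]fp_mulE; apply/fp_classP; exact: fp_constM.
Qed.

Lemma fp_varV i : (fp_var i)^-1 = fp_class [:: inr (i, false)].
Proof.
apply: (mulgI (fp_var i)); rewrite mulgV; symmetry; rewrite [LHS]fp_mulE.
by apply/fp_classP; exact: fp_cancel.
Qed.

Section Extension.
Variables (B : groupType) (f : A -> B) (h : 'I_r -> B).

Definition letter_eval (x : letter) : B :=
  match x with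
  | inl a => f a
  | inr (i, e) => if e then h i else (h i)^-1
  end.

Definition fp_extend (w : freeprod) : B := \prod_(x <- fp_repr w) letter_eval x.

Hypothesis f_morph : monoid.monoid_morphism f.

Lemma letter_eval_fp_eq s t : fp_eq s t ->
  \prod_(x <- s) letter_eval x = \prod_(x <- t) letter_eval x.
Proof.
elim=> {s t} //.
- by move=> t u v _ -> _ ->.
- by move=> t t' u u' _ IHt _ IHu; rewrite !big_cat IHt IHu.
- by rewrite big_seq1 big_nil /= f_morph.1.
- by move=> a b; rewrite big_cons !big_seq1 /= f_morph.2.
- move=> i [] /=; rewrite big_cons big_seq1 big_nil /=.
    by rewrite mulgV.
  by rewrite mulVg.
Qed.

Lemma fp_extend_class s : fp_extend (fp_class s) = \prod_(x <- s) letter_eval x.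
Proof. exact: letter_eval_fp_eq (fp_classK s). Qed.

Lemma fp_extend_morph : monoid.monoid_morphism fp_extend.
Proof.
split=> [|v w]; first by rewrite [LHS]fp_extend_class big_nil.
by rewrite [LHS]fp_extend_class big_cat.
Qed.

Lemma fp_extend_const a : fp_extend (fp_const a) = f a.
Proof. by rewrite fp_extend_class big_seq1. Qed.

Lemma fp_extend_var i : fp_extend (fp_var i) = h i.
Proof. by rewrite fp_extend_class big_seq1. Qed.

Lemma fp_extend_unique (phi : freeprod -> B) : monoid.monoid_morphism phi ->
  (forall a, phi (fp_const a) = f a) -> (forall i, phi (fp_var i) = h i) ->
  phi =1 fp_extend.
Proof.
move=> [phi1 phiM] phi_const phi_var w.
rewrite -[w]fp_reprK fp_extend_class; elim: (fp_repr w) => [|x s IHs].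
  by rewrite big_nil.
rewrite big_cons -IHs -cat1s -fp_mulE phiM; congr (_ * _).
case: x => [a|[i []]] /=; [exact: phi_const | exact: phi_var|].
apply: (mulgI (h i)); rewrite mulgV -fp_varV -[X in X * _]phi_var -phiM.
by rewrite mulgV.
Qed.

End Extension.

(* The expression c_0 x_i(1)^e(1) c_1 ... x_i(l)^e(l) c_l is encoded as the
   constant c_0 and the sequence of the triples (i(j), e(j), c_j), 1 <= j <= l,
   with e(j) = true for exponent 1 and e(j) = false for exponent -1. *)
Definition syllable : Type := ('I_r * bool * A)%type.

Definition fp_word (c0 : A) (s : seq syllable) : freeprod :=
  fp_const c0 *
  \prod_(p <- s) ((if p.1.2 then fp_var p.1.1 else (fp_var p.1.1)^-1)
                  * fp_const p.2).

(* [sorted] relates (i(j), e(j), c_j) to (i(j+1), e(j+1), c_(j+1)) for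
   1 <= j < l, so that only the inner constants are constrained. *)
Definition reduced (s : seq syllable) : bool :=
  sorted (fun p q : syllable =>
    if (p.1.1 == q.1.1) && (p.1.2 == ~~ q.1.2) then p.2 \notin center A
    else ~~ ((p.2 \in center A) && (p.2 != 1))) s.

Definition fp_subst (w : freeprod) (h : 'I_r -> A) : A := fp_extend id h w.

Definition mixed_identity (w : freeprod) : Prop :=
  (exists (c0 : A) (s : seq syllable),
      [/\ w = fp_word c0 s, reduced s & (1 <= size s)%N]) /\
  (forall h : 'I_r -> A, fp_subst w h = 1).

End FreeProduct.

Definition no_mixed_identities (A : groupType) : Prop :=
  forall r : nat, (1 <= r)%N -> forall w : freeprod A r, ~ mixed_identity w.

(* Main.v *)
(* The dichotomy is governed by whether H contains a finitary element that is
   not scalar. Since F is finite, g is finitary iff some g - l with l != 0 takes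
   finitely many values.

   If g is such an element, say g - l has values in A, then for every h the map
   g^h g^-1 - 1 takes values in a space of dimension at most 2|A|, so all orbits
   of g^h g^-1 have length bounded independently of h, and a large power of
   x^-1 g x g^-1 is a mixed identity. Products of conjugates of g move arbitrarily
   long independent tuples to independent complements, and high transitivity of H
   transfers this to all independent tuples.

   Otherwise, for each non-central c in H and each l, the map c - l has infinite
   range. Given a reduced word, one follows a vector v letter by letter, building
   finite partial maps for the variables: each new image v' is chosen so that v'
   and its image under the next constant are independent of all vectors met so
   far, which is possible because finitely many cosets of subspaces of infinite
   index do not cover V. The word then moves v. *)

Require Import Defs.
From HB Require Import structures.
From mathcomp Require Import all_boot all_order all_algebra.
From mathcomp Require Import boolp classical_sets cardinality.

Set Implicit Arguments.
Unset Strict Implicit.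
Unset Printing Implicit Defensive.

Import GRing.Theory.

Local Open Scope ring_scope.

(** Choice, made total: [p t] is arbitrary where nothing is related to [t]. Mostly used to pick one
    vector in each fibre of a map. *)
Lemma partial_section (X T : Type) (x0 : X) (R : X -> T -> Prop) :
  exists p : T -> X, forall t x, R x t -> R (p t) t.
Proof.
suff H : forall t, exists y, forall x, R x t -> R y t.
  by have [p pP] := choice H; exists p.
move=> t.
by have [[x Rx]|nR] := pselect (exists x, R x t);
  [exists x | exists x0 => x Rx; case: nR; exists x].
Qed.

(** * Spans and linear independence of finite lists *)

Section Spans.
Variables (F : finFieldType) (V : lmodType F).
Implicit Types (s t : seq V) (u v w : V).

(** As [F] is finite, a finitely generated subspace is a finite list, possibly with repetitions;
    membership in it is then decidable. *)
Fixpoint lspan s : seq V :=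
  if s is u :: s' then [seq a *: u + w | a <- enum F, w <- lspan s']
  else [:: 0].

Lemma lspan_consP u s v :
  reflect (exists a, v - a *: u \in lspan s) (v \in lspan (u :: s)).
Proof.
apply: (iffP allpairsP) => [[[a w] /= [_ ws ->]]|[a vs]].
  by exists a; rewrite addrC addKr.
by exists (a, v - a *: u); split; rewrite ?mem_enum //= subrKC.
Qed.

Lemma size_lspan s : size (lspan s) = (#|F| ^ size s)%N.
Proof. by elim: s => //= u s IH; rewrite size_allpairs IH -cardE expnS. Qed.

Lemma lspan_linear s a u v :
  u \in lspan s -> v \in lspan s -> a *: u + v \in lspan s.
Proof.
elim: s u v => [|x s IH] u v /=.
  by rewrite !inE => /eqP-> /eqP->; rewrite scaler0 addr0.
move=> /lspan_consP[b bP] /lspan_consP[c cP]; apply/lspan_consP.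
exists (a * b + c).
by have := IH _ _ bP cP; rewrite scalerBr scalerA scalerDl opprD addrACA.
Qed.

Lemma lspan0 s : 0 \in lspan s.
Proof.
elim: s => [|u s IH]; first by rewrite inE.
by apply/lspan_consP; exists 0; rewrite scale0r subr0.
Qed.

Lemma lspanZ s a u : u \in lspan s -> a *: u \in lspan s.
Proof. by move=> us; rewrite -[_ *: _]addr0 lspan_linear ?lspan0. Qed.

Lemma lspanD s u v : u \in lspan s -> v \in lspan s -> u + v \in lspan s.
Proof. by move=> us vs; rewrite -[u]scale1r lspan_linear. Qed.

Lemma lspanB s u v : u \in lspan s -> v \in lspan s -> u - v \in lspan s.
Proof. by move=> us vs; rewrite addrC -scaleN1r lspan_linear. Qed.

Lemma lspanZr s a u : a != 0 -> (a *: u \in lspan s) = (u \in lspan s).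
Proof.
move=> a0; apply/idP/idP; last exact: lspanZ.
by move=> /(lspanZ a^-1); rewrite scalerA mulVf ?scale1r.
Qed.

Lemma lspan_cons u s : {subset lspan s <= lspan (u :: s)}.
Proof. by move=> v vs; apply/lspan_consP; exists 0; rewrite scale0r subr0. Qed.

Lemma lspan_head u s : u \in lspan (u :: s).
Proof. by apply/lspan_consP; exists 1; rewrite scale1r subrr lspan0. Qed.

Lemma mem_lspan s : {subset s <= lspan s}.
Proof.
elim: s => // u s IH v; rewrite inE => /orP[/eqP->|/IH]; first exact: lspan_head.
exact: lspan_cons.
Qed.

Lemma lspan_min s t :
  {subset s <= lspan t} -> {subset lspan s <= lspan t}.
Proof.
elim: s => [|u s IH] st v /=; first by rewrite inE => /eqP->; exact: lspan0.
move=> /lspan_consP[a /IH vs]; rewrite -[v](subrK (a *: u)) lspanD //.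
  by apply: vs => x xs; apply: st; rewrite inE xs orbT.
by apply: lspanZ; apply: st; exact: mem_head.
Qed.

Lemma lspan_sub s t : {subset s <= t} -> {subset lspan s <= lspan t}.
Proof. by move=> st; apply: lspan_min => v /st; exact: mem_lspan. Qed.

Lemma lspan_exchange u v s :
  u \notin lspan s -> u \in lspan (v :: s) -> v \in lspan (u :: s).
Proof.
move=> us /lspan_consP[a aP].
have a0 : a != 0 by apply: contraNneq us => a0; rewrite a0 scale0r subr0 in aP.
apply/lspan_consP; exists a^-1; rewrite -(lspanZr _ _ a0).
rewrite scalerBr scalerA divff // scale1r.
by rewrite -(lspanZr _ _ (_ : -1 != 0)) ?oppr_eq0 ?oner_eq0 // scaleN1r opprB.
Qed.

Fixpoint indep s : bool :=
  if s is u :: s' then (u \notin lspan s') && indep s' else true.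

(** The recursion in [indep] depends on the order of the list; by exchange, any entry can be brought
    to the front. *)
Lemma indep_middle s u t : indep (s ++ u :: t) = indep (u :: s ++ t).
Proof.
elim: s => //= v s ->; rewrite -/(lspan (v :: _)) /=.
have e : lspan (s ++ u :: t) =i lspan (u :: s ++ t).
  by move=> w; apply/idP/idP; apply: lspan_sub => x;
    rewrite !(inE, mem_cat) orbCA.
rewrite e !andbA; congr (_ && _).
apply/andP/andP => -[h1 h2]; split.
- by apply: contra h1; exact: lspan_exchange.
- by apply: contra h1; exact: lspan_cons.
- by apply: contra h1; exact: lspan_exchange.
- by apply: contra h1; exact: lspan_cons.
Qed.

Lemma indep_scale s t a : a != 0 -> indep (map ( *:%R a) s ++ t) = indep (s ++ t).
Proof.
move=> a0; elim: s => //= u s ->; rewrite lspanZr //; congr (~~ _ && _).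
apply/idP/idP; apply: lspan_min => v; rewrite mem_cat => /orP[|vt].
- by move=> /mapP[w ws ->]; rewrite lspanZr // mem_lspan // mem_cat ws.
- by rewrite mem_lspan // mem_cat vt orbT.
- move=> vs; rewrite -(lspanZr _ _ a0) mem_lspan // mem_cat.
  by rewrite map_f.
- by rewrite mem_lspan // mem_cat vt orbT.
Qed.

Lemma indep_cat s t : indep (s ++ t) -> indep t.
Proof. by elim: s => //= u s IH /andP[_ /IH]. Qed.

(** Greedy choice: a vector of [s] is kept only when it is outside the span of [t] and the vectors
    kept before. *)
Lemma extend_basis s t : exists r, indep (r ++ t) = indep t /\
  lspan (r ++ t) =i lspan (s ++ t).
Proof.
elim: s => [|u s [r [ir er]]]; first by exists [::].
have [us|us] := boolP (u \in lspan (r ++ t)).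
  exists r; split=> // v; rewrite er; apply/idP/idP; first exact: lspan_cons.
  apply: lspan_min => w; rewrite inE -er => /orP[/eqP->|/mem_lspan] //.
  by rewrite -er.
exists (u :: r); split; first by rewrite /= us.
by move=> v; apply/lspan_consP/lspan_consP => -[a ha]; exists a;
  move: ha; rewrite er.
Qed.

Lemma lspan_combP n (b : 'I_n -> V) v :
  reflect (exists a, v = lin_comb b a) (v \in lspan (codom b)).
Proof.
apply: (iffP idP) => [|[a ->]]; last first.
  apply: (big_ind (fun x => x \in lspan _)) => [|x y|i _].
  - exact: lspan0.
  - exact: lspanD.
  - by rewrite lspanZ ?mem_lspan ?codom_f.
elim: n b v => [|n IH] b v.
  rewrite codomE enum_ord0 inE => /eqP->; exists (fun=> 0).
  by rewrite /lin_comb big_ord0.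
rewrite codomE enum_ordSl /= -map_comp => /lspan_consP[a0].
rewrite -codomE => /IH[a e].
exists (fun i => if unlift ord0 i is Some j then a j else a0).
rewrite /lin_comb big_ord_recl unlift_none -[LHS](subrKC (a0 *: b ord0)) e.
by congr (_ + _); apply: eq_bigr => i _; rewrite liftK.
Qed.

Lemma lin_indepE n (b : 'I_n -> V) : lin_indep b <-> indep (codom b).
Proof.
elim: n b => [|n IH] b.
  by rewrite codomE enum_ord0; split => // _ a _ [].
rewrite codomE enum_ordSl /= -map_comp -codomE.
split=> [ib|/andP[h /IH ib] a ab i].
  apply/andP; split; last first.
    apply/IH => a ab i.
    have := ib (fun i => if unlift ord0 i is Some j then a j else 0) _
      (lift ord0 i).
    rewrite liftK; apply; rewrite /lin_comb big_ord_recl unlift_none scale0r add0r.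
    by rewrite -[RHS]ab; apply: eq_bigr => j _; rewrite liftK.
  apply/negP => /lspan_combP[a e].
  suff /ib/(_ ord0)/eqP : lin_comb b
      (fun i => if unlift ord0 i is Some j then a j else -1) = 0.
    by rewrite unlift_none oppr_eq0 oner_eq0.
  rewrite /lin_comb big_ord_recl unlift_none scaleN1r e addrC.
  rewrite -[X in _ - X]/(lin_comb _ _).
  by apply/eqP; rewrite subr_eq0; apply/eqP;
    apply: eq_bigr => j _; rewrite liftK.
have a00 : a ord0 = 0.
  apply: contraNeq h => h; rewrite -(lspanZr _ _ h).
  apply/lspan_combP; exists (fun i => - a (lift ord0 i)).
  move/eqP: ab; rewrite /lin_comb big_ord_recl addr_eq0 => /eqP->.
  by rewrite -sumrN; apply: eq_bigr => j _; rewrite scaleNr.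
move: ab; rewrite /lin_comb big_ord_recl a00 scale0r add0r => /ib ab.
by case: (unliftP ord0 i) => [j|] ->.
Qed.

End Spans.

(** * Vectors avoiding finite sets *)

Lemma indep_uniq (F : finFieldType) (V : lmodType F) (s : seq V) :
  indep s -> uniq s.
Proof.
elim: s => //= u s IH /andP[us /IH->]; rewrite andbT.
by apply: contra us; exact: mem_lspan.
Qed.

Lemma infinite_dim_fresh (F : finFieldType) (V : lmodType F) :
  countably_infinite_dim V -> forall A : seq V, exists v, v \notin A.
Proof.
move=> [e [ie _]] A.
have /lin_indepE/indep_uniq ue := ie (size A).+1.
have /allPn[v _ vA] : ~~ all (mem A) (codom (fun i : 'I_(size A).+1 => e i)).
  apply/allP => /(uniq_leq_size ue).
  by rewrite size_codom card_ord ltnn.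
by exists v.
Qed.

(* Finitely many cosets of subgroups of infinite index do not cover V (B. H.
   Neumann): a fibre of [f i] avoiding A would be covered by the remaining
   cosets, hence so would all its translates. *)
Lemma avoid_images (V : zmodType) (I : eqType) (f : I -> V -> V) (r : seq I) :
    (forall i, {morph f i : x y / x - y}) ->
    (forall i, i \in r -> forall A : seq V, exists v, f i v \notin A) ->
  forall A : seq V, exists v, forall i, i \in r -> f i v \notin A.
Proof.
move=> fB; have f0 i : f i 0 = 0 by have := fB i 0 0; rewrite !subrr.
have fD i x y : f i (x + y) = f i x + f i y.
  by rewrite -[in LHS](opprK y) fB -(sub0r y) fB f0 sub0r opprK.
elim: r => [|i r IH] finf A; first by exists 0.
have [x xA] := finf i (mem_head _ _) A.
have [p pP] := partial_section (0 : V) (fun v t => f i v = t).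
(* If [f i v] falls in [A], moving [v] by [x - p (f i v)] turns this value into [f i x]; [D] lists
   the effect of such moves on the other maps. *)
pose D := [seq f j (x - p a) | j <- r, a <- A].
have [j jr B|v vP] := IH _ (A ++ [seq b - d | b <- A, d <- D]).
  by apply: finf; rewrite inE jr orbT.
have [vA|vA] := boolP (f i v \in A); last first.
  exists v => j; rewrite inE => /orP[/eqP->//|/vP].
  by rewrite mem_cat => /norP[].
exists (v + (x - p (f i v))) => j; rewrite inE => /orP[/eqP->|jr].
  by rewrite fD fB (pP _ v) // addrC subrK.
have := vP _ jr; rewrite mem_cat => /norP[_]; apply: contra => jA.
apply/allpairsP; exists (f j (v + (x - p (f i v))), f j (x - p (f i v))).
by split=> //=; [exact: allpairs_f | rewrite fD addrK].
Qed.

(** * Linear transitivity in terms of lists *)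

Section Transitivity.
Variables (F : finFieldType) (V : lmodType F).
Implicit Types (K : {pred GL V}) (g h : GL V) (s t : seq V).

Lemma GL_mulE g h v : (g * h)%g v = h (g v). Proof. by []. Qed.
Lemma GL_oneE v : (1%g : GL V) v = v. Proof. by []. Qed.
Lemma GL_invK g : cancel g (g^-1)%g. Proof. exact: GLV_funK. Qed.
Lemma GL_Kinv g : cancel (g^-1)%g g. Proof. exact: GL_funVK. Qed.

Lemma GLB g u v : g (u - v) = g u - g v. Proof. exact: linearB. Qed.
Lemma GLD g u v : g (u + v) = g u + g v. Proof. exact: linearD. Qed.
Lemma GLZ g a v : g (a *: v) = a *: g v. Proof. exact: linearZ. Qed.

Lemma highly_transitive_seqP K : 1%g \in K ->
  highly_linearly_transitive K <->
  (forall s t, size s = size t -> indep s -> indep t ->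
     exists2 h, h \in K & map h s = t).
Proof.
move=> K1; split=> [tr s t|tr k _ u w /lin_indepE iu /lin_indepE iw].
  (* Empty lists are outside [highly_linearly_transitive], where [k] is positive; the identity
     serves for them. *)
  have [s0|s0] := posnP (size s).
    rewrite (size0nil s0) => /esym/size0nil -> _ _.
    by exists 1%g.
  have sE : s = codom (tnth (in_tuple s)) by rewrite codomE map_tnth_enum.
  move=> st; rewrite {1}sE => /lin_indepE is_.
  have tE : t = codom (fun i : 'I_(size s) =>
      tnth (tcast (esym st) (in_tuple t)) i).
    by rewrite codomE map_tnth_enum val_tcast.
  rewrite {1}tE => /lin_indepE it.
  have [h hK hP] := tr _ s0 _ _ is_ it; exists h => //.
  by rewrite sE tE !codomE -map_comp; apply: eq_map => i /=; rewrite hP.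
have [|h hK hP] := tr _ _ _ iu iw; first by rewrite !size_codom.
exists h => // i; move: hP; rewrite !codomE -map_comp => /eq_in_map.
by apply; rewrite mem_enum.
Qed.

Lemma lspan_map g s v : v \in lspan s -> g v \in lspan (map g s).
Proof.
elim: s v => [|u s IH] v /=.
  by rewrite !inE => /eqP->; rewrite linear0.
move=> /lspan_consP[a /IH]; rewrite GLB GLZ => ga.
by apply/lspan_consP; exists a.
Qed.

Definition finitary g (l : F) (A : seq V) := forall v, g v - l *: v \in A.

Lemma indep_map g s : indep (map g s) = indep s.
Proof.
elim: s => //= u s ->; congr (~~ _ && _); apply/idP/idP => [|/lspan_map->//].
by move=> /(lspan_map g^-1%g); rewrite (mapK (GL_invK g)) GL_invK.
Qed.

End Transitivity.

(** * Finite rank as finiteness of the range *)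

Section Finitary.
Variables (F : finFieldType) (V : lmodType F).
Implicit Types (K : {pred GL V}) (g h : GL V) (s t : seq V).

Lemma rk_finite (f : V -> V) : linear f ->
  rk f <> None <-> exists A : seq V, forall v, f v \in A.
Proof.
move=> f_lin; rewrite /rk /dimension.
case: pselect => [ex|nb]; split=> //; last case=> A fA.
  move=> _; have [n [b [_ fb]]] := ex.
  exists (lspan (codom b)) => v; apply/lspan_combP.
  have : range (lin_comb b) (f v) by rewrite -fb; exists v.
  by case=> a _ <-; exists a.
case: nb; have [p pP] := partial_section (0 : V) (fun v c => f v = c).
(* [A] may contain vectors outside the range of [f], so each entry is replaced by a genuine value of
   [f]. *)
pose s := [seq f (p a) | a <- A].
have [r [ir rs]] := extend_basis s [::].
rewrite !cats0 in ir rs.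
have rE : r = codom (tnth (in_tuple r)) by rewrite codomE map_tnth_enum.
exists (size r), (tnth (in_tuple r)); split.
  by apply/lin_indepE; rewrite -rE ir.
have fs v : f v \in s by rewrite -(pP _ v erefl) map_f.
apply/seteqP; split=> [_ [v _ <-]|_ [a _ <-]].
  have : f v \in lspan r by rewrite rs mem_lspan.
  by rewrite {1}rE => /lspan_combP[a ->]; exists a.
have : lin_comb (tnth (in_tuple r)) a \in lspan s.
  by rewrite -rs {4}rE; apply/lspan_combP; exists a.
have f0 : f 0 = 0 by have := f_lin (-1) 0 0;
  rewrite scaler0 addr0 scaleN1r addNr.
rewrite /s; elim: A {fA s fs rs} (lin_comb _ _) => [|c A IH] w /=.
  by rewrite inE => /eqP->; exists 0.
by move=> /lspan_consP[d /IH[v _ e]]; exists (d *: p c + v);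
  rewrite // f_lin e addrC subrK.
Qed.

Lemma GLfinP g :
  g \in GLfin V <-> exists l A, l != 0 /\ finitary g l A.
Proof.
have lin l : linear (fun v => g v - l *: v).
  move=> a u v; rewrite linearP scalerDr opprD addrACA scalerBr.
  by rewrite !scalerA (mulrC l).
rewrite inE /= /GLnorm; split=> [|[l [A [l0 gA]]]].
  apply: contraPP => nfin; apply/negP; rewrite negbK; apply/eqP.
  apply: big1 => l l0.
  apply: contrapT => /(rk_finite (lin l)) [A gA].
  by apply: nfin; exists l, A.
rewrite (bigD1 l) //=.
have : rk (fun v => g v - l *: v) <> None by apply/rk_finite => //; exists A.
by case: rk => // n _; case: (\big[_/_]_(_ | _) _).
Qed.

End Finitary.

(** * The group of finitary maps, unipotent exponents and scalars *)

Section FinitaryGroup.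
Variables (F : finFieldType) (V : lmodType F).
Implicit Types (K : {pred GL V}) (g h u : GL V) (A B : seq V) (v w : V).

(** The difference lies in the kernel of [g - l]; subtracting a representative of its fibre thus
    carries any vector into this eigenspace. *)
Lemma eigen_sub g l v w :
  g w - l *: w = g v - l *: v -> g (v - w) = l *: (v - w).
Proof.
move=> /esym/eqP; rewrite subr_eq => /eqP gv.
by rewrite GLB gv scalerBr addrAC (addrAC (g _)) subrr sub0r addrC.
Qed.

Lemma finitary1 : finitary (1%g : GL V) 1 [:: 0].
Proof. by move=> v; rewrite GL_oneE scale1r subrr inE. Qed.

(** With maps acting on the right, [g h^-1 - l/m = (g - l) h^-1 - (l/m) (h - m) h^-1]. *)
Lemma finitary_div g h l m A B : m != 0 -> finitary g l A -> finitary h m B ->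
  finitary (g / h)%g (l / m)
    [seq (h^-1)%g a - (l / m) *: (h^-1)%g b | a <- A, b <- B].
Proof.
move=> m0 gA hB v.
suff -> : (g / h)%g v - (l / m) *: v =
    (h^-1)%g (g v - l *: v) - (l / m) *: (h^-1)%g (h v - m *: v).
  exact: (allpairs_f (fun a b => (h^-1)%g a - (l / m) *: (h^-1)%g b)).
rewrite GL_mulE !GLB !GLZ. rewrite GL_invK scalerBr scalerA.
by rewrite divfK // opprB addrA subrK.
Qed.

Lemma finitary_conj g h l A : finitary g l A -> finitary (g ^ h)%g l (map h A).
Proof.
move=> gA v; apply/mapP; exists (g ((h^-1)%g v) - l *: (h^-1)%g v) => //.
by rewrite conjgE !GL_mulE GLB GLZ GL_Kinv.
Qed.

Lemma GLfin_group : group_closed (GLfin V).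
Proof.
split=> [|g h].
  by apply/GLfinP; exists 1, [:: 0]; rewrite oner_eq0; split=> //; exact: finitary1.
move=> /GLfinP[l [A [l0 gA]]] /GLfinP[m [B [m0 hB]]]; apply/GLfinP.
eexists _, _; split; last exact: finitary_div gA hB.
by rewrite mulf_neq0 ?invr_neq0.
Qed.

Lemma GLfin_conj g h : g \in GLfin V -> (g ^ h)%g \in GLfin V.
Proof.
move=> /GLfinP[l [A [l0 gA]]]; apply/GLfinP.
by eexists _, _; split; last exact: finitary_conj gA.
Qed.

Lemma GL_expE g n v : (g ^+ n)%g v = iter n g v.
Proof.
elim: n => [|n IH] //; rewrite expgSr GL_mulE IH //.
Qed.

(* Every orbit stays in a coset of [lspan B], so has length at most
   [#|F| ^ size B]. *)
Lemma unipotent_exponent u B : (forall v, u v - v \in lspan B) ->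
  (u ^+ (#|F| ^ size B)`!)%g = 1%g.
Proof.
move=> uB; apply: GLP => v; rewrite GL_expE -size_lspan.
have itB i : iter i u v - v \in lspan B.
  elim: i => [|i IH]; first by rewrite subrr lspan0.
  by rewrite /= -(subrKA (iter i u v)) lspanD.
have /(uniqPn 0)[i [j [ij jM]]] :
    ~~ uniq [seq iter i u v - v | i <- iota 0 (size (lspan B)).+1].
  apply/negP => /uniq_leq_size le; have := le (lspan B).
  rewrite size_map size_iota ltnn => absurd.
  by suff: false by []; apply: absurd => _ /mapP[i _ ->]; exact: itB.
rewrite size_map size_iota in jM.
have iM := ltn_trans ij jM.
rewrite !(nth_map 0%N) ?size_iota // !nth_iota // => /(addIr (- v)).
rewrite !add0n -(subnKC (ltnW ij)) iterD => e.
have {e} fixd : iter (j - i) u v = v.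
  apply/esym; move: (j - i)%N e => d.
  by elim: i {ij iM} => //= i IH /(bij_inj (GL_bij u)).
(* The period [j - i] depends on [v] but never exceeds [size (lspan B)], so the factorial is a
   multiple of every such period. *)
have /dvdnP[q ->] : (j - i %| (size (lspan B))`!)%N.
  by rewrite dvdn_fact // subn_gt0 ij (leq_trans (leq_subr _ _)).
by rewrite iterM iter_fix.
Qed.

Lemma mem_lineP v w : reflect (exists a, w = a *: v) (w \in lspan [:: v]).
Proof.
apply: (iffP (lspan_consP _ _ _)) => -[a].
  by rewrite inE subr_eq0 => /eqP->; exists a.
by move=> ->; exists a; rewrite subrr inE.
Qed.

(** If all lines are preserved, comparing the eigenvalues at [v], [e] and [v + e] shows that they
    agree. *)
Lemma scalar_or_moves_line g :
  (exists v, g v \notin lspan [:: v]) \/ (exists l, forall v, g v = l *: v).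
Proof.
have [|line] := pselect (exists v, g v \notin lspan [:: v]); [by left | right].
have {}line v : exists a, g v = a *: v.
  by apply/mem_lineP/negPn/negP => gv; apply: line; exists v.
have [[e e0]|triv] := pselect (exists e : V, e != 0); last first.
  exists 1 => v; have v0 : v = 0.
    by apply: contrapT => /eqP v0; apply: triv; exists v.
  by rewrite v0 linear0 scaler0.
have [l gl] := line e; exists l => v.
have [/mem_lineP[a ->]|ve] := boolP (v \in lspan [:: e]).
  by rewrite GLZ gl !scalerA mulrC.
have [m gm] := line v; have [n gn] := line (v + e).
have mn : m = n.
  apply: contraNeq ve; rewrite -subr_eq0 => mn; rewrite -(lspanZr _ _ mn).
  apply/mem_lineP; exists (n - l); apply/eqP.
  rewrite !scalerBl subr_eq -addrA (addrC (- _)) addrA -scalerDr (addrC e).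
  by rewrite -gn GLD gm gl /= addrK.
move: gn; rewrite GLD gm gl mn scalerDr => /addrI/eqP.
by rewrite -subr_eq0 -scalerBl scaler_eq0 (negPf e0) orbF subr_eq0 => /eqP->.
Qed.

End FinitaryGroup.

(** * Evaluation of words *)

Section WordValue.
Local Open Scope group_scope.
Variables (A : groupType) (r : nat).

Definition word_value (h : 'I_r -> A) (s : seq (syllable A r)) : A :=
  \prod_(p <- s) ((if p.1.2 then h p.1.1 else (h p.1.1)^-1) * p.2).

Lemma fp_subst_word c0 s h : fp_subst (fp_word c0 s) h = c0 * word_value h s.
Proof.
have idM : monoid.monoid_morphism (@id A) by [].
have [phi1 phiM] := fp_extend_morph h idM.
rewrite /fp_subst phiM fp_extend_const //; congr (_ * _).
rewrite /word_value; elim: s => [|[[i e] c] s IH]; first by rewrite !big_nil.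
rewrite !big_cons phiM phiM IH fp_extend_const //; congr (_ * _ * _).
case: e => /=; first exact: fp_extend_var.
by rewrite fp_varV fp_extend_class // big_seq1.
Qed.

End WordValue.

(** * Central elements of [H] as scalars *)

Section Subgroup.
Variables (F : finFieldType) (V : lmodType F) (H : groupClosed (GL V)).
Implicit Types (c : subgroup H) (v : V).

Lemma subgroup1 : val (1%g : subgroup H) = 1%g. Proof. by []. Qed.
Lemma subgroupM c d : val (c * d)%g = (val c * val d)%g. Proof. by []. Qed.

Lemma noncentral_moves_line c : c \notin center (subgroup H) ->
  exists v, val c v \notin lspan [:: v].
Proof.
have [//|[l cl]] := scalar_or_moves_line (val c).
move=> /negP[]; apply/asboolP => x; apply: val_inj; apply: GLP => v.
by rewrite !subgroupM !GL_mulE !cl GLZ.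
Qed.

Hypothesis Htr : highly_linearly_transitive H.

(** Transitivity gives [h] in [H] that fixes [v] and sends [c v] to [v + c v]; it does not commute
    with [c]. *)
Lemma moves_line_noncentral c v :
  val c v \notin lspan [:: v] -> c \notin center (subgroup H).
Proof.
move=> cv; have /highly_transitive_seqP tr : 1%g \in H by exact: gpred1.
have [v0|v0] := eqVneq v 0; first by rewrite v0 linear0 lspan0 in cv.
have iv : indep [:: val c v; v] by rewrite /= cv inE v0.
have ivD : indep [:: v + val c v; v].
  rewrite /= inE v0 !andbT; apply: contra cv => h.
  by rewrite -[val c v](addKr v) addrC lspanB // lspan_head.
have [h hH [hc hv]] :=
  tr.1 Htr [:: val c v; v] [:: v + val c v; v] erefl iv ivD.
apply/negP => /asboolP/(_ (exist _ h hH))/(congr1 (fun x : subgroup H => val x v)).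
rewrite !subgroupM !GL_mulE /= hv hc => /eqP.
by rewrite -subr_eq0 addrK (negPf v0).
Qed.

End Subgroup.

(** * Absence of mixed identities in the infinitary case *)

Section NoMixedIdentities.
Variables (F : finFieldType) (V : lmodType F) (H : groupClosed (GL V)).
Hypothesis Vinf : forall A : seq V, exists v, v \notin A.
Hypothesis Htr : highly_linearly_transitive H.
Hypothesis Hinf : forall c : subgroup H, c \notin center (subgroup H) ->
  forall l (A : seq V), exists v, val c v - l *: v \notin A.

Lemma choose_image (c : subgroup H) (S : seq V) : exists v,
  [/\ v \notin lspan S, val c v \notin lspan S
    & c \notin center (subgroup H) -> val c v \notin lspan (v :: S)].
Proof.
(* [None] stands for the identity and [Some l] for [c - l]; when all [c - l] avoid [lspan S], [c v]
   stays out of [lspan (v :: S)]. *)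
pose f (o : option F) v := if o is Some l then val c v - l *: v else v.
have fB o : {morph f o : x y / x - y}.
  by case: o => [l|] x y //; rewrite /f GLB scalerBr !opprD addrACA.
pose r := [:: None, Some 0 & if c \in center (subgroup H) then [::]
          else map Some (enum F)].
have cinf (A : seq V) : exists v, val c v \notin A.
  have [v vA] := Vinf (map (val c)^-1%g A); exists v.
  by apply: contra vA => cA; rewrite -[v](GL_invK (val c)) map_f.
have [|v vP] := @avoid_images V _ f r fB _ (lspan S).
  move=> o; rewrite !inE => /or3P[/eqP->|/eqP->|].
  - exact: Vinf.
  - by move=> A; have [v vA] := cinf A; exists v; rewrite /= scale0r subr0.
  - by case: ifP => // /negbT cN /mapP[l _ ->]; apply: Hinf.
exists v; split.
- exact: (vP None).
- by have := vP (Some 0); rewrite /= scale0r subr0; apply; rewrite !inE eqxx.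
- move=> cN; apply/lspan_consP => -[l]; apply/negP; apply: (vP (Some l)).
  by rewrite /r (negPf cN) !inE map_f ?orbT // mem_enum.
Qed.

(* [X i true] and [X i false] list the domain and the image of a finite partial
   map to which [h i] is still constrained; the letter x_i^e sends the head of
   [X i e] to that of [X i (~~ e)]. *)
Lemma word_escape r (s : seq (syllable (subgroup H) r)) : reduced s ->
  forall (X : 'I_r -> bool -> seq V) (S0 S : seq V) (v : V),
    {subset S0 <= lspan S} -> v \in lspan S ->
    (forall i b, indep (X i b)) ->
    (forall i, size (X i true) = size (X i false)) ->
    (forall i b, {subset X i b <= lspan S}) ->
    v \notin lspan (if s is p :: _ then X p.1.1 p.1.2 else S0) ->
  exists h : 'I_r -> subgroup H,
    (forall i, map (val (h i)) (X i true) = X i false) /\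
    val (word_value h s) v \notin lspan S0.
Proof.
have /highly_transitive_seqP [tr _] : 1%g \in H by exact: gpred1.
elim: s => [_|[[i e] c] s IH red] X S0 S v S0S vS iX sX XS vX.
  have hP i : exists h : subgroup H, map (val h) (X i true) = X i false.
    have [h hH hX] := tr Htr _ _ (sX i) (iX _ _) (iX _ _).
    by exists (exist _ h hH).
  have [h hX] := choice hP; exists h; split=> //.
  by rewrite /word_value big_nil.
rewrite /= in vX.
have [v' [v'S cv'S cv'N]] := choose_image c S.
pose X1 j b := if j == i then (if b == e then v else v') :: X j b else X j b.
have XsS j b : {subset lspan (X j b) <= lspan S} by apply: lspan_min; exact: XS.
have SS1 : {subset lspan S <= lspan (val c v' :: v' :: S)}.
  by move=> x xS; do 2 apply: lspan_cons.
have [|x xS0|||j|j b x||h [hX hs]] := IH _ X1 S0 (val c v' :: v' :: S) (val c v').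
- exact: path_sorted red.
- exact: SS1 (S0S x xS0).
- exact: lspan_head.
- move=> j b; rewrite /X1; case: eqP => [->|_] //=; rewrite iX andbT.
  case: eqP => [->|_]; first exact: vX.
  by apply: contra v'S; exact: XsS.
- by rewrite /X1; case: eqP => //= ->; rewrite sX.
- rewrite /X1; case: eqP => [_|_ /XS/SS1] //; rewrite inE.
  case/orP=> [/eqP->|/XS/SS1] //; case: ifP => _; first exact: SS1.
  by apply: lspan_cons; exact: lspan_head.
(* If the next letter repeats [x_i^e], the new entry of its list is [v], already in [lspan S]. If it
   is the inverse letter, the entry is [v'], and reducedness makes [c] non-central. *)
- case: s {IH} red => [_|[[i' e'] c'] s] /=.
    by apply: contra cv'S; apply: lspan_min.
  move=> /andP[/= ic _]; rewrite /X1.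
  case: eqP => [ii'|_]; last by apply: contra cv'S; exact: XsS.
  rewrite ii' eqxx /= in ic.
  case: eqP => [ee'|ee'].
    apply: contra cv'S; apply: lspan_min => x; rewrite inE.
    by case/orP=> [/eqP->|/XS].
  have e_e' : e == ~~ e' by case: (e) (e') ee' => [] [].
  rewrite e_e' in ic; apply: contra (cv'N ic); apply: lspan_min => x.
  rewrite inE => /orP[/eqP->|/XS]; first exact: lspan_head.
  exact: lspan_cons.
exists h; split.
  move=> j; have := hX j; rewrite /X1; case: eqP => //= _.
  by move=> [_].
rewrite /word_value big_cons subgroupM GL_mulE subgroupM GL_mulE /=.
suff -> : val (if e then h i else (h i)^-1%g) v = v' by [].
have := hX i; rewrite /X1 eqxx /=.
case: (e) => /= -[hv _]; first by [].
by rewrite -hv; exact: GL_invK.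
Qed.

Lemma infinitary_no_mixed_identities : no_mixed_identities (subgroup H).
Proof.
move=> r _ w [[c0 [s [-> red s1]]] w1].
have [v v0] := Vinf [:: 0]; rewrite inE in v0.
have S0 : {subset [:: v] <= lspan [:: val c0 v; v]}.
  by move=> x; rewrite inE => /eqP->; apply: mem_lspan; rewrite !inE eqxx orbT.
(* All partial maps start empty. As [s] is nonempty, [c0 v] only has to be nonzero at the start; the
   final vector leaves the line of [v]. *)
have [||||h [_]] := @word_escape r s red (fun _ _ => [::]) [:: v] _ (val c0 v) S0
  (lspan_head _ _) _ _ _ _.
- by [].
- by [].
- by [].
- case: s {red w1} s1 => //= p s _; rewrite inE.
  by rewrite -[X in _ == X](linear0 (val c0)) (can_eq (GL_invK _)).
- have := w1 h; rewrite fp_subst_word => /(congr1 (fun x : subgroup H => val x v)).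
  by rewrite subgroupM GL_mulE => ->; rewrite lspan_head.
Qed.

End NoMixedIdentities.

(** * A mixed identity from a non-central finitary element *)

Section FinitaryIdentity.
Variables (F : finFieldType) (V : lmodType F) (H : groupClosed (GL V)).
Variables (g : subgroup H) (l : F) (A : seq V).
Hypothesis gN : g \notin center (subgroup H).
Hypothesis gA : finitary (val g) l A.

(** The word [(x^-1 g x g^-1)^N] in one variable [x]. *)
Definition commutator_power (N : nat) : seq (syllable (subgroup H) 1) :=
  flatten (nseq N [:: (ord0, false, g); (ord0, true, g^-1%g)]).

Lemma commutator_power_reduced N : reduced (commutator_power N).
Proof.
have gVN : g^-1%g \notin center (subgroup H).
  apply: contra gN => /asboolP gVC; apply/asboolP => x.
  by apply: commute_sym; rewrite -[g]invgK; apply: commuteV; apply: commute_sym.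
(* [p] is the last syllable of a block; placing it in front makes the induction over blocks
   uniform. *)
pose p : syllable (subgroup H) 1 := (ord0, true, g^-1%g).
rewrite /reduced; set R := (R in sorted R _).
suff : path R p (commutator_power N) by exact: path_sorted.
by elim: N => //= N IH; apply/and3P; split; [exact: gVN | exact: gN |].
Qed.

Lemma commutator_power_value N h :
  word_value h (commutator_power N) = (((h ord0)^-1 * g * h ord0 * g^-1) ^+ N)%g.
Proof.
elim: N => [|N IH]; first by rewrite /word_value big_nil.
by move: IH; rewrite /word_value /= !big_cons expgS => -> /=; rewrite !mulgA.
Qed.

Lemma finitary_mixed_identity : ~ no_mixed_identities (subgroup H).
Proof.
pose N := (#|F| ^ (size A + size A))`!.
move=> /(_ 1%N isT (fp_word 1%g (commutator_power N))); apply; split.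
  exists 1%g, (commutator_power N); split=> //.
    exact: commutator_power_reduced.
  by have : (0 < N)%N := fact_gt0 _; case: (N).
move=> h; rewrite fp_subst_word mul1g commutator_power_value; set x := h ord0.
set u := (_ * _)%g; apply: val_inj.
have valX n : val (u ^+ n)%g = (val u ^+ n)%g.
  by elim: n => // n IH; rewrite !expgS subgroupM IH.
rewrite valX subgroup1 /N.
(* With right actions [u - 1 = (g^x - g) g^-1], and [g^x - g] is the difference of [g^x - l] and
   [g - l]. The size of [B] does not depend on [x]. *)
pose B := [seq (val g)^-1%g a | a <- [seq val x a | a <- A] ++ A].
have <- : size B = (size A + size A)%N by rewrite size_map size_cat size_map.
apply: unipotent_exponent => v.
have uE : val u = ((val g) ^ (val x) * (val g)^-1)%g by rewrite conjgE !mulgA.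
rewrite uE GL_mulE -{2}[v](GL_invK (val g)) -GLB.
rewrite -(subrKA (l *: v)) -[l *: v - _]opprB GLB.
rewrite lspanB // mem_lspan // map_f // mem_cat ?gA ?orbT //.
by rewrite (finitary_conj (val x) gA).
Qed.

End FinitaryIdentity.

(** * Cartesian products of finite lists *)

Section Products.
Variable T : eqType.

Definition seqprods (As : seq (seq T)) : seq (seq T) :=
  foldr (fun A Bs => [seq a :: b | a <- A, b <- Bs]) [:: [::]] As.

Lemma mem_seqprods (X : eqType) (s : seq X) (f : X -> T) (A : X -> seq T) :
  (forall x, x \in s -> f x \in A x) -> map f s \in seqprods (map A s).
Proof.
elim: s => // x s IH fA /=; apply: allpairs_f; first by apply: fA; exact: mem_head.
by apply: IH => y ys; apply: fA; rewrite inE ys orbT.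
Qed.

End Products.

(** * Local finiteness of the finitary group *)

Section LocallyFinite.
Variables (F : finFieldType) (V : lmodType F).

(* The group generated by s consists of maps u acting as a scalar l on the
   common kernel U of the g - l_g, which has finite index, such that u - l takes
   values in the finite space spanned by the images of the g - l_g. *)
Lemma GLfin_locally_finite (s : seq (GL V)) : {subset s <= GLfin V} ->
  finite_set (generated s).
Proof.
move=> sfin.
have [p pP] : {p : GL V -> F * seq V & forall g, g \in GLfin V ->
    (p g).1 != 0 /\ finitary g (p g).1 (p g).2}.
  apply: (@choice (GL V) (F * seq V)%type (fun g q => g \in GLfin V ->
    q.1 != 0 /\ finitary g q.1 q.2)) => g.
  have [/GLfinP[l [A lA]]|gN] := boolP (g \in GLfin V); first by exists (l, A).
  by exists (0, [::]).
pose W := lspan (flatten [seq (p g).2 | g <- s]).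
pose phi v := [seq g v - (p g).1 *: v | g : GL V <- s].
pose U v := forall g, g \in s -> g v = (p g).1 *: v.
(* The nonempty fibres of [phi] are the cosets of [U], so [C] contains a representative of each
   coset. *)
have [q qP] := partial_section (0 : V) (fun v t => phi v = t).
pose C := map q (seqprods [seq (p g).2 | g <- s]).
have CP v : exists2 c, c \in C & U (v - c).
  exists (q (phi v)).
    by rewrite map_f //; apply: mem_seqprods => g /sfin/pP[_]; exact.
  move=> g gs; have /eq_in_map/(_ g gs) := qP _ v erefl.
  exact: eigen_sub.
pose acts (l : F) (u : GL V) :=
  [/\ l != 0, forall v, u v - l *: v \in W & forall v, U v -> u v = l *: v].
have WP g v : g \in s -> g v - (p g).1 *: v \in W.
  move=> gs; apply/mem_lspan/flattenP; exists (p g).2; first exact: map_f.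
  by have [_] := pP g (sfin g gs); exact.
have inv l (u : GL V) : acts l u ->
    (forall v, (u^-1)%g v - l^-1 *: v \in W) /\
    (forall w, w \in W -> (u^-1)%g w \in W).
  case=> l0 uW _.
  have uWW w : w \in W -> u w \in W.
    by move=> wW; rewrite -(subrK (l *: w) (u w)) lspanD // lspanZ.
  have VW w : w \in W -> (u^-1)%g w \in W.
    (* Being injective, [u] permutes the finite set [W], hence so does its inverse. *)
    have [_ eqW] : (size (map u (undup W)) = size (undup W)) *
        (map u (undup W) =i undup W).
      apply: uniq_min_size; last by rewrite size_map.
      - by rewrite map_inj_uniq ?undup_uniq //; exact: bij_inj (GL_bij u).
      - by move=> _ /mapP[x xW ->]; rewrite mem_undup uWW // -mem_undup.
    rewrite -mem_undup -eqW => /mapP[x xW ->].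
    by rewrite GL_invK -mem_undup.
  split=> // v; rewrite -[X in _ - l^-1 *: X](GL_Kinv u).
  set w := (u^-1)%g v; rewrite -(lspanZr _ _ (_ : - l != 0)) ?oppr_eq0 //.
  by rewrite scaleNr scalerBr scalerA divff // scale1r opprB uW.
have acts1 : acts 1 1%g.
  by split=> [|v|v _]; rewrite ?oner_eq0 // GL_oneE scale1r ?subrr ?lspan0.
have actsF l m (u w : GL V) : acts l u -> acts m w -> acts (l / m) (u / w)%g.
  move=> [l0 uW uU] mw; have [wVW wVWW] := inv _ _ mw.
  have [m0 wW wU] := mw.
  split=> [|v|v Uv]; first by rewrite mulf_neq0 ?invr_neq0.
    have -> : (u / w)%g v - (l / m) *: v = (w^-1)%g (u v - l *: v)
        + l *: ((w^-1)%g v - m^-1 *: v).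
      by rewrite GL_mulE GLB GLZ scalerBr scalerA addrA subrK.
    by rewrite lspanD ?wVWW ?lspanZ.
  rewrite GL_mulE (uU _ Uv) GLZ -scalerA; congr (_ *: _).
  apply: (bij_inj (GL_bij w)).
  by rewrite GL_Kinv GLZ wU // scalerA mulVf // scale1r.
have genP u : u \in generated s -> exists l, acts l u.
  rewrite inE => /(_ [pred u | `[< exists l, acts l u >]]) gen.
  apply/asboolP; apply: gen.
    split=> [|x y /asboolP[l lx] /asboolP[m my]]; apply/asboolP.
      by exists 1.
    by exists (l / m); exact: actsF.
  move=> g gs; apply/asboolP; exists (p g).1; split=> [|v|v Uv].
  - by case: (pP g (sfin g gs)).
  - exact: WP.
  - exact: Uv.
(* Since [V = U + C], an element is determined by [l] and the vectors [u c - l c] of [W], for [c] in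
   [C]: finitely many codes. *)
have codeP (u u' : GL V) l : acts l u -> acts l u' ->
    [seq u c - l *: c | c <- C] = [seq u' c - l *: c | c <- C] -> u = u'.
  move=> [_ _ uU] [_ _ uU'] /eq_in_map e; apply: GLP => v.
  have [c cC Uvc] := CP v; rewrite -(subrK c v) (GLD u (v - c)) (GLD u' (v - c)).
  rewrite (uU _ Uvc) (uU' _ Uvc).
  by congr (_ + _); apply: (addIr (- (l *: c))); exact: e.
pose code (u : GL V) (t : F * seq V) :=
  acts t.1 u /\ t.2 = [seq u c - t.1 *: c | c <- C].
have [b bP] := partial_section (1%g : GL V) code.
pose B := [seq (l, t) | l <- enum F, t <- seqprods [seq W | c <- C]].
apply: (@sub_finite_set _ _ [set` map b B]); last exact: finite_seq.
move=> u /mem_set/genP[l lu] /=.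
have [ub e] := bP (l, [seq u c - l *: c | c <- C]) u (conj lu erefl).
rewrite (codeP _ _ _ lu ub e); apply: map_f; apply: allpairs_f.
  by rewrite mem_enum.
by apply: (mem_seqprods (A := fun=> W)) => c _; case: lu.
Qed.

End LocallyFinite.

(** * High transitivity of the finitary part of [H] *)

Section FinitaryTransitive.
Variables (F : finFieldType) (V : lmodType F) (H : groupClosed (GL V)).
Hypothesis Vinf : forall A : seq V, exists v, v \notin A.
Hypothesis Htr : highly_linearly_transitive H.

Let HF : {pred GL V} := [predI H & GLfin V].

Lemma HF_group : group_closed HF.
Proof.
have [f1 fF] := GLfin_group V.
split=> [|x y /andP[xH xf] /andP[yH yf]]; first by rewrite inE /= gpred1.
by apply/andP; split; [exact: gpredF | exact: fF].
Qed.

Lemma HF_conj g h : g \in HF -> h \in H -> (g ^ h)%g \in HF.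
Proof.
by move=> /andP[gH gf] hH; apply/andP; split; [exact: gpredJ | exact: GLfin_conj].
Qed.

Variables (g0 : GL V) (l0 : F) (A0 : seq V) (b : V).
Hypotheses (g0H : g0 \in HF) (l0_neq0 : l0 != 0) (g0A : finitary g0 l0 A0).
Hypothesis g0b : g0 b \notin lspan [:: b].

(** Otherwise the translates of [S] by finitely many fibre representatives would cover [V]. *)
Lemma finitary_kernel_fresh (S : seq V) : exists2 v, g0 v = l0 *: v & v \notin S.
Proof.
have [p pP] := partial_section (0 : V) (fun v c => g0 v - l0 *: v = c).
have [v vS] := Vinf [seq p a + x | a <- A0, x <- S].
pose v' := p (g0 v - l0 *: v); exists (v - v').
  by apply: eigen_sub; exact: (pP _ v).
apply: contra vS => vS; rewrite -(subrKC v' v).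
by apply: allpairs_f.
Qed.

(** Transitivity of [H] can carry this configuration to any independent list of the same length,
    conjugating [g0] accordingly. *)
Lemma finitary_kernel_indep k : exists c : seq V,
  [/\ size c = k, {in c, forall v, g0 v = l0 *: v} & indep (c ++ [:: g0 b; b])].
Proof.
elim: k => [|k [c [sc cl ic]]].
  exists [::]; split=> //=; rewrite g0b inE andbT.
  by apply: contraNneq g0b => ->; rewrite linear0 lspan0.
have [v gv vc] := finitary_kernel_fresh (lspan (c ++ [:: g0 b; b])).
exists (v :: c); split; rewrite /= ?sc ?vc //.
by move=> w; rewrite inE => /orP[/eqP->|/cl].
Qed.

(* Conjugating [g0] so that it is scalar on the [g a_i] but moves [g b'] to a
   fresh vector z, the product [g * g0 ^ h] moves the tuple b', a to z, l0 g a. *)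
Lemma finitary_moves_indep k : exists2 g, g \in HF &
  exists2 a : seq V, size a = k & indep (map g a ++ a).
Proof.
have [HF1 HFF] := HF_group.
have /highly_transitive_seqP [tr _] : 1%g \in H by exact: gpred1.
elim: k => [|k [g gHF [a sa ia]]]; first by exists 1%g => //; exists [::].
have [b' b'a] := Vinf (lspan (map g a ++ a)).
(* Avoiding the first span makes the new tuple and its image independent; avoiding the second lets
   [z] be the image of [g0 b] under [h]. *)
have [z] := Vinf (lspan (map g a ++ b' :: a) ++ lspan (map g a ++ [:: g b'])).
rewrite mem_cat => /norP[za zb].
have [c [sc cl ic]] := finitary_kernel_indep k.
have it : indep (map g a ++ [:: z; g b']).
  rewrite indep_middle /= zb indep_middle cats0 /=.
  have := indep_map g (b' :: a); rewrite /= => ->.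
  by rewrite (indep_cat ia) andbT; apply: contra b'a; apply: lspan_sub => x xa;
    rewrite mem_cat xa orbT.
have [|h hH] := tr Htr _ _ _ ic it; first by rewrite !size_cat /= size_map sa sc.
rewrite map_cat => /eqP; rewrite eqseq_cat ?size_map ?sa ?sc //.
move=> /andP[/eqP hc /eqP[hz hb]].
have g0Z x : x \in map g a -> (g0 ^ h)%g x = l0 *: x.
  rewrite -hc => /mapP[y yc ->].
  by rewrite conjgE !GL_mulE GL_invK cl // GLZ.
exists (g * g0 ^ h)%g.
  by apply: (group_closedM HF_group) => //; exact: HF_conj.
exists (b' :: a); first by rewrite /= sa.
rewrite map_cons.
have -> : [seq (g * g0 ^ h)%g x | x <- a] = [seq l0 *: x | x <- map g a].
  by rewrite -map_comp; apply/eq_in_map => x xa; rewrite GL_mulE g0Z // map_f.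
have -> : (g * g0 ^ h)%g b' = z.
  by rewrite GL_mulE conjgE !GL_mulE -hb GL_invK hz.
rewrite cat_cons -indep_middle indep_scale // indep_middle /= za.
by rewrite indep_middle /= b'a.
Qed.

Lemma HF_highly_transitive : highly_linearly_transitive HF.
Proof.
have [HF1 HFF] := HF_group.
have /highly_transitive_seqP [tr _] : 1%g \in H by exact: gpred1.
apply/highly_transitive_seqP => // s t st is_ it.
have [g gHF [a sa ia]] := finitary_moves_indep (size s).
have [r [sr irs irt]] : exists r,
    [/\ size r = size s, indep (r ++ s) & indep (r ++ t)].
  elim: (size s) => [|k [r [sr irs irt]]]; first by exists [::].
  have [v] := Vinf (lspan (r ++ s) ++ lspan (r ++ t)).
  rewrite mem_cat => /norP[vs vt].
  by exists (v :: r); rewrite /= sr vs vt.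
(* If [h] carries [map g a ++ a] to [r ++ x], then [g ^ h] takes [x] to [r]. Both [s] and [t] are
   thus moved to the common tuple [r]. *)
have move x : size x = size s -> indep (r ++ x) ->
    exists2 f, f \in HF & map f x = r.
  move=> sx irx; have [|h hH] := tr Htr _ _ _ ia irx.
    by rewrite !size_cat size_map sa sr sx.
  rewrite map_cat => /eqP; rewrite eqseq_cat ?size_map ?sa ?sr //.
  move=> /andP[/eqP hr /eqP hx]; exists (g ^ h)%g; first exact: HF_conj.
  rewrite -hx -hr -!map_comp; apply: eq_map => y; rewrite /comp.
  by rewrite conjgE !GL_mulE GL_invK.
have [f fHF fs] := move s erefl irs.
have [f' fHF' ft] := move t (esym st) irt.
exists (f / f')%g; first exact: HFF.
have -> : [seq (f / f')%g x | x <- s] = map f'^-1%g (map f s).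
  by rewrite -map_comp; apply: eq_map => y.
by rewrite fs -ft (mapK (GL_invK f')).
Qed.

End FinitaryTransitive.

Theorem theorem5 (F : finFieldType) (V : lmodType F) (H : groupClosed (GL V)) :
  countably_infinite_dim V ->
  highly_linearly_transitive H ->
  let HF : {pred GL V} := [predI H & GLfin V] in
  let case_i := [/\ highly_linearly_transitive HF,
                    locally_finite HF
                  & normal_subgroup HF H] in
  let case_ii := no_mixed_identities (subgroup H) in
  (case_i \/ case_ii) /\ ~ (case_i /\ case_ii).
Proof.
move=> /infinite_dim_fresh Vinf Htr HF case_i case_ii.
have [[g [gHF [b gb]]]|nofin] :=
  pselect (exists g, g \in HF /\ exists v, g v \notin lspan [:: v]).
  have /andP[gH /GLfinP[l [A [l0 gA]]]] := gHF.
  split; [left; split | move=> [_]].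
  - exact: HF_highly_transitive gHF l0 gA gb.
  - by move=> s sHF; apply: GLfin_locally_finite => x /sHF/andP[].
  - split; first exact: HF_group.
    + by move=> x /andP[].
    + by move=> x y xHF yH; exact: HF_conj.
  - apply: (@finitary_mixed_identity _ _ H (exist _ g gH) l A) => //.
    exact: (moves_line_noncentral Htr (v := b)).
split; [right | move=> [[HFtr _ _] _]].
  apply: infinitary_no_mixed_identities => // c /noncentral_moves_line mc l A.
  apply: contrapT => cA.
  have {}cA v : val c v - l *: v \in A.
    by apply/negPn/negP => vA; apply: cA; exists v.
  (* For [l = 0] the bijection [c] would have finite range in the infinite [V]; otherwise [c] would
     be finitary and move a line. *)
  have [l0|l0] := eqVneq l 0.
    have [v /negP[]] := Vinf (map (val c)^-1%g A).
    by rewrite -[v](GL_invK (val c)) map_f //;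
      have := cA v; rewrite l0 scale0r subr0.
  apply: nofin; exists (val c); split=> //; apply/andP; split; first exact: valP.
  by apply/GLfinP; exists l, A.
(* Transitivity of [HF] on single vectors would already move [v] off its line, against [nofin]. *)
have [v v0] := Vinf [:: 0]; have [w wv] := Vinf (lspan [:: v]).
have HF1 : 1%g \in HF by case: (HF_group H).
have [|||h hHF [hv]] := (highly_transitive_seqP HF1).1 HFtr [:: v] [:: w] => //=.
- by rewrite v0.
- by rewrite andbT; apply: contra wv; rewrite inE => /eqP->; exact: lspan0.
by apply: nofin; exists h; split=> //; exists v; rewrite hv.
Qed.
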